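(* For every fixed $n\ge2$, the sequence of matrices $\{\psi(\Omega_n^k)\}_{k\in\mathbb{N}}$ stabilizes positively as $k\to\infty$. The limit is formally equivalent to a matrix of rational functions in $T$, given explicitly by $$\psi(\Omega_n^\infty)_{ij}=\lim_{k\to\infty}\psi(\Omega_n^k)_{ij}=\frac{T^{j-1}}{1+T+\cdots+T^{n-1}}\qquad(1\le i,j\le n).$$
   Context: $B_n$ is the $n$-strand braid group with standard generators $\sigma_1,\dots,\sigma_{n-1}$, and $\Omega_n=(\sigma_1\sigma_2\cdots\sigma_{n-1})^n\in B_n$ is the full twist. The (unreduced) Burau representation $\psi:B_n\to\mathrm{GL}_n(\mathbb{Z}[T,T^{-1}])$ is determined by $$\psi(\sigma_k)=\begin{bmatrix}I_{k-1}&0&0&0\\0&1-T&T&0\\0&1&0&0\\0&0&0&I_{n-k-1}\end{bmatrix},\qquad k=1,\dots,n-1.$$ A sequence $\{p_t\}$ in $\mathbb{Z}[T,T^{-1}]$ stabilizes positively if for every $r_0\in\mathbb{Z}$ there is $t_0$ such that for all $t\ge t_0$ and all $r\le r_0$ the coefficients of $T^r$ in $p_t$ and $p_{t_0}$ agree; its limit is the resulting formal Laurent series. A sequence of matrices over $\mathbb{Z}[T,T^{-1}]$ stabilizes positively if each entry does, and the limit is taken entrywise. Rational functions are identified with their Laurent expansions at $T=0$. *)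

(* Defs.v *)
From HB Require Import structures.
From mathcomp Require Import all_boot all_order all_algebra.
From mathcomp Require Import generic_quotient.
From mathcomp Require Import boolp classical_sets cardinality fsbigop.
From mathcomp Require Import zify ring.

Set Implicit Arguments.
Unset Strict Implicit.
Unset Printing Implicit Defensive.

Import Order.TTheory GRing.Theory Num.Theory.
Local Open Scope ring_scope.
Local Open Scope quotient_scope.

Section LaurentSeries.
Variable R : comNzRingType.

Record lseries := LSeries {
  lcoef : int -> R;
  lcoef_bounded : exists a : int, forall r, r < a -> lcoef r = 0
}.

HB.instance Definition _ := gen_eqMixin lseries.
HB.instance Definition _ := gen_choiceMixin lseries.

Lemma lseriesP (f g : lseries) : lcoef f =1 lcoef g -> f = g.
Proof.
case: f g => [f hf] [g hg] /= /funext fg; move: hf hg; rewrite fg => hf hg.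
by congr LSeries; exact: Prop_irrelevance.
Qed.

Fact lzero_bounded : exists a : int, forall r : int, r < a -> 0 = 0 :> R.
Proof. by exists 0. Qed.
Definition lzero := LSeries lzero_bounded.

Fact ladd_bounded (f g : lseries) :
  exists a : int, forall r, r < a -> lcoef f r + lcoef g r = 0.
Proof.
case: (lcoef_bounded f) (lcoef_bounded g) => a fa [b gb].
by exists (Order.min a b) => r; rewrite lt_min => /andP[ra rb]; rewrite fa ?gb ?addr0.
Qed.
Definition ladd f g := LSeries (ladd_bounded f g).

Fact lopp_bounded (f : lseries) :
  exists a : int, forall r, r < a -> - lcoef f r = 0.
Proof.
by case: (lcoef_bounded f) => a fa; exists a => r ra; rewrite fa ?oppr0.
Qed.
Definition lopp f := LSeries (lopp_bounded f).

Fact laddA : associative ladd.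
Proof. by move=> f g h; apply: lseriesP => r /=; rewrite addrA. Qed.
Fact laddC : commutative ladd.
Proof. by move=> f g; apply: lseriesP => r /=; rewrite addrC. Qed.
Fact ladd0 : left_id lzero ladd.
Proof. by move=> f; apply: lseriesP => r /=; rewrite add0r. Qed.
Fact laddN : left_inverse lzero lopp ladd.
Proof. by move=> f; apply: lseriesP => r /=; rewrite addNr. Qed.

HB.instance Definition _ := GRing.isZmodule.Build lseries laddA laddC ladd0 laddN.

(* Cauchy product. For Laurent series the family [i |-> f i * g (r - i)] has
   finite support, since the supports of f and g are bounded below. *)
Definition lconv (f g : int -> R) (r : int) : R :=
  \sum_(i \in [set: int]) f i * g (r - i).

Lemma lconv_window (f g : int -> R) (r c : int) (K : nat) :
    (forall k : int, (k < 0) || (K%:Z <= k) -> f (k - c) * g (r - (k - c)) = 0) ->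
  lconv f g r = \sum_(k < K) f (k%:Z - c) * g (r - (k%:Z - c)).
Proof.
move=> H; rewrite /lconv (@reindex_fsbigT _ _ _ _ _ (fun k : int => k - c)); last first.
  by exists (fun k => k + c) => k; rewrite ?subrK ?addrK.
rewrite -(big_mkord xpredT (fun k => f (k%:Z - c) * g (r - (k%:Z - c)))).
rewrite (fsbigE [seq Posz k | k <- index_iota 0 K]) /=.
- by rewrite big_map; apply: eq_bigl => k; rewrite in_setT.
- by rewrite map_inj_uniq ?iota_uniq // => a b [].
- by [].
move=> k _ hk; apply: H; apply: contraNT hk; rewrite negb_or -leNgt -ltNge.
case: k => // k /andP[_ kK]; apply/mapP; exists k => //.
by rewrite mem_index_iota.
Qed.

Fact lmul_bounded (f g : lseries) :
  exists a : int, forall r, r < a -> lconv (lcoef f) (lcoef g) r = 0.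
Proof.
case: (lcoef_bounded f) (lcoef_bounded g) => a fa [b gb]; exists (a + b) => r rab.
rewrite (@lconv_window _ _ _ 0 0) ?big_ord0 // => k _.
have [ka|ka] := ltP (k - 0) a; first by rewrite fa ?mul0r.
by rewrite gb ?mulr0 //; lia.
Qed.
Definition lmul f g := LSeries (lmul_bounded f g).

Fact lone_bounded : exists a : int, forall r : int, r < a -> (r == 0)%:R = 0 :> R.
Proof. by exists 0 => r r0; rewrite lt_eqF. Qed.
Definition lone := LSeries lone_bounded.

Lemma lcoef_nat_bound (f : lseries) :
  exists N : nat, forall r, r < - N%:Z -> lcoef f r = 0.
Proof.
case: (lcoef_bounded f) => a fa; exists `|a|%N => r ra; apply: fa; lia.
Qed.

Lemma nat_gt_int (z : int) : exists K : nat, z < K%:Z.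
Proof. by exists `|z|.+1; lia. Qed.

Fact lmulC : commutative lmul.
Proof.
move=> f g; apply: lseriesP => r /=; rewrite /lconv.
rewrite (@reindex_fsbigT _ _ _ _ _ (fun k : int => r - k)) /=; last first.
  by exists (fun k => r - k) => k; ring.
by apply: eq_fsbigr => k _; rewrite mulrC; congr (lcoef _ _ * _); ring.
Qed.

Fact lmul1 : left_id lone lmul.
Proof.
move=> f; apply: lseriesP => r /=; rewrite (@lconv_window _ _ _ 0 1).
  by rewrite big_ord_recl big_ord0 addr0 !subr0 /= mul1r.
move=> k hk; have -> : (k - 0 == 0) = false by lia.
by rewrite mul0r.
Qed.

Fact lmulDl : left_distributive lmul ladd.
Proof.
move=> f g h; apply: lseriesP => r /=.
case: (lcoef_nat_bound f) (lcoef_nat_bound g) (lcoef_nat_bound h) => F hf [G hg] [H hh].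
case: (nat_gt_int (r + (F + G + H)%:Z *+ 2)) => K hK.
rewrite (@lconv_window _ _ r (F + G + H)%:Z K); last first.
  move=> k /orP[k0|Kk]; first by rewrite /= hf ?hg ?addr0 ?mul0r //; lia.
  by rewrite hh ?mulr0 //; lia.
rewrite (@lconv_window _ _ r (F + G + H)%:Z K); last first.
  move=> k /orP[k0|Kk]; first by rewrite hf ?mul0r //; lia.
  by rewrite hh ?mulr0 //; lia.
rewrite (@lconv_window _ _ r (F + G + H)%:Z K); last first.
  move=> k /orP[k0|Kk]; first by rewrite hg ?mul0r //; lia.
  by rewrite hh ?mulr0 //; lia.
by rewrite -big_split /=; apply: eq_bigr => k _; rewrite mulrDl.
Qed.

Fact lmulA : associative lmul.
Proof.
move=> f g h; apply: lseriesP => r /=.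
case: (lcoef_nat_bound f) (lcoef_nat_bound g) (lcoef_nat_bound h) => F hf [G hg] [H hh].
pose N := (F + G + H)%N.
have {}hf k : k < - N%:Z -> lcoef f k = 0 by move=> kN; apply: hf; lia.
have {}hg k : k < - N%:Z -> lcoef g k = 0 by move=> kN; apply: hg; lia.
have {}hh k : k < - N%:Z -> lcoef h k = 0 by move=> kN; apply: hh; lia.
have hfg k : k < - (N%:Z + N%:Z) -> lconv (lcoef f) (lcoef g) k = 0.
  move=> kN; rewrite (@lconv_window _ _ _ 0 0) ?big_ord0 // => i _.
  have [ia|ia] := ltP (i - 0) (- N%:Z); first by rewrite hf ?mul0r.
  by rewrite hg ?mulr0 //; lia.
have hgh k : k < - (N%:Z + N%:Z) -> lconv (lcoef g) (lcoef h) k = 0.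
  move=> kN; rewrite (@lconv_window _ _ _ 0 0) ?big_ord0 // => i _.
  have [ia|ia] := ltP (i - 0) (- N%:Z); first by rewrite hg ?mul0r.
  by rewrite hh ?mulr0 //; lia.
case: (nat_gt_int (`|r| + N%:Z *+ 3)) => K hK.
rewrite (@lconv_window _ _ _ N%:Z K); last first.
  move=> k /orP[k0|Kk]; first by rewrite hf ?mul0r //; lia.
  by rewrite hgh ?mulr0 //; lia.
rewrite (@lconv_window _ _ _ (N%:Z + N%:Z) K); last first.
  move=> k /orP[k0|Kk]; first by rewrite hfg ?mul0r //; lia.
  by rewrite hh ?mulr0 //; lia.
transitivity (\sum_(l < K) \sum_(k < K) lcoef f (l%:Z - N%:Z) *
    (lcoef g (k%:Z - (l%:Z + N%:Z)) *
     lcoef h (r - (k%:Z - (N%:Z + N%:Z))))).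
  apply: eq_bigr => l _; rewrite -big_distrr /=; congr (_ * _).
  rewrite (@lconv_window _ _ _ (l%:Z + N%:Z) K); last first.
    move=> k /orP[k0|Kk]; first by rewrite hg ?mul0r //; lia.
    by rewrite hh ?mulr0 //; lia.
  by apply: eq_bigr => k _; congr (_ * lcoef _ _); ring.
rewrite exchange_big /=; apply: eq_bigr => k _.
rewrite (@lconv_window _ _ _ N%:Z K); last first.
  move=> l /orP[l0|Kl]; first by rewrite hf ?mul0r //; lia.
  by rewrite hg ?mulr0 //; have := ltn_ord k; lia.
rewrite big_distrl /=; apply: eq_bigr => l _; rewrite mulrA.
by congr (_ * lcoef _ _ * _); ring.
Qed.

Fact lone_neq0 : lone != 0.
Proof.
by apply/eqP => /(congr1 (fun f => lcoef f 0)) /= /eqP; rewrite oner_eq0.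
Qed.

HB.instance Definition _ :=
  GRing.Zmodule_isComNzRing.Build lseries lmulA lmulC lmul1 lmulDl lone_neq0.

Lemma lcoefM (f g : lseries) r :
  lcoef (f * g) r = \sum_(i \in [set: int]) lcoef f i * lcoef g (r - i).
Proof. by []. Qed.

Fact lmonomial_bounded (m : int) :
  exists a : int, forall r : int, r < a -> (r == m)%:R = 0 :> R.
Proof. by exists m => r rm; rewrite lt_eqF. Qed.
Definition lmonomial m : lseries := LSeries (lmonomial_bounded m).

Fact poly_lseries_bounded (p : {poly R}) : exists a : int, forall r : int,
  r < a -> (if r is Posz k then p`_k else 0) = 0.
Proof. by exists 0 => -[]. Qed.
Definition poly_lseries (p : {poly R}) : lseries :=
  LSeries (poly_lseries_bounded p).

End LaurentSeries.

Section LaurentPolynomials.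
Variable R : comNzRingType.

Definition lfinite : {pred lseries R} :=
  fun f => `[< exists b : int, forall r, b < r -> lcoef f r = 0 >].

Fact lfinite_subring : subring_closed lfinite.
Proof.
split=> [|f g|f g].
- by apply/asboolP; exists 0 => r r0 /=; rewrite gt_eqF.
- move=> /asboolP[a fa] /asboolP[b gb]; apply/asboolP; exists (Order.max a b) => r.
  by rewrite gt_max => /andP[ra rb]; rewrite /= fa ?gb ?subr0.
move=> /asboolP[a fa] /asboolP[b gb]; apply/asboolP; exists (a + b) => r rab.
rewrite /= (@lconv_window _ _ _ _ 0 0) ?big_ord0 // => k _.
have [ka|ka] := ltP a (k - 0); first by rewrite fa ?mul0r.
by rewrite gb ?mulr0 //; lia.
Qed.

HB.instance Definition _ :=
  GRing.isSubringClosed.Build (lseries R) lfinite lfinite_subring.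

Record lpoly := LPoly { lpoly_val :> lseries R; _ : lfinite lpoly_val }.

HB.instance Definition _ := [isSub for lpoly_val].
HB.instance Definition _ := [Choice of lpoly by <:].
HB.instance Definition _ := [SubChoice_isSubComNzRing of lpoly by <:].

(* Invertibility in R[T, T^-1] itself, not in R((T)). *)
Definition lp_unit : {pred lpoly} := fun f => `[< exists g, g * f = 1 >].

Definition lp_inv (f : lpoly) : lpoly :=
  if pselect (exists g, g * f = 1) is left h then projT1 (cid h) else f.

Fact lp_mulVf : {in lp_unit, left_inverse 1 lp_inv *%R}.
Proof.
move=> f /asboolP fu; rewrite /lp_inv; case: pselect => // h.
by case: (cid h).
Qed.

Fact lp_unitP (f g : lpoly) : g * f = 1 -> lp_unit f.
Proof. by move=> gf; apply/asboolP; exists g. Qed.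

Fact lp_inv_out : {in [predC lp_unit], lp_inv =1 id}.
Proof.
move=> f /negP nf; rewrite /lp_inv; case: pselect => // h.
by case: nf; apply/asboolP.
Qed.

HB.instance Definition _ :=
  GRing.ComNzRing_hasMulInverse.Build lpoly lp_mulVf lp_unitP lp_inv_out.

Fact lpmonomial_finite m : lfinite (lmonomial R m).
Proof. by apply/asboolP; exists m => r rm /=; rewrite gt_eqF. Qed.
Definition lpmonomial m : lpoly := LPoly (lpmonomial_finite m).

Definition lpT : lpoly := lpmonomial 1.

Lemma lpT_unit : lpT \is a GRing.unit.
Proof.
apply/asboolP; exists (lpmonomial (-1)); apply/val_inj/lseriesP => r.
rewrite /= (@lconv_window _ _ _ _ 1 1).
  rewrite big_ord_recl big_ord0 addr0 sub0r /= mul1r.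
  by congr (_%:R); lia.
move=> k hk /=; have -> : (k - 1 == -1) = false by lia.
by rewrite mul0r.
Qed.

End LaurentPolynomials.

Section Expansion.
Variable R : idomainType.

(* F = p / q in Frac(R[T]), and q * s = p in R((T)); by
   [laurent_expansion_uniq], F determines s. *)
Definition laurent_expansion (F : {fraction {poly R}}) (s : lseries R) : Prop :=
  exists p q : {poly R}, [/\ q != 0, F = tofrac p / tofrac q &
    poly_lseries q * s = poly_lseries p].

Lemma lseries_order (f : lseries R) : f != 0 ->
  exists m : int, lcoef f m != 0 /\ forall r, r < m -> lcoef f r = 0.
Proof.
move=> f0; have [N hN] := lcoef_nat_bound f.
have ex : exists k, lcoef f (k%:Z - N%:Z) != 0.
  apply: contrapT => /forallNP nf; move/eqP: f0; apply; apply: lseriesP => r /=.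
  have [rN|rN] := ltP r (- N%:Z); first exact: hN.
  have /negP/negPn/eqP := nf (absz (r + N%:Z)).
  by congr (lcoef _ _ = 0); lia.
case: (ex_minnP ex) => m fm mmin; exists (m%:Z - N%:Z); split=> // r rm.
have [rN|rN] := ltP r (- N%:Z); first exact: hN.
apply/eqP/negPn/negP => fr; have := mmin (absz (r + N%:Z)).
have -> : (absz (r + N%:Z))%:Z - N%:Z = r by lia.
by move=> /(_ fr); lia.
Qed.

Lemma lseries_mulf_eq0 (f g : lseries R) : f * g = 0 -> (f == 0) || (g == 0).
Proof.
move=> fg; apply: contraT; rewrite negb_or => /andP[].
move=> /lseries_order[a [fa fl]] /lseries_order[b [gb gl]].
have := congr1 (fun f => lcoef f (a + b)) fg.
rewrite /= (@lconv_window _ _ _ _ (- a) 1).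
  rewrite big_ord_recl big_ord0 addr0 sub0r opprK addrC addKr => /eqP.
  by rewrite mulf_eq0 (negPf fa) (negPf gb).
move=> k /orP[k0|k1]; first by rewrite fl ?mul0r //; lia.
by rewrite gl ?mulr0 //; lia.
Qed.

Lemma poly_lseriesM (p q : {poly R}) :
  poly_lseries (p * q) = poly_lseries p * poly_lseries q.
Proof.
have posE (g : {poly R}) (r : int) k : r = k%:Z -> lcoef (poly_lseries g) r = g`_k.
  by move=> ->.
have negE (g : {poly R}) (r : int) : r < 0 -> lcoef (poly_lseries g) r = 0.
  by case: r.
apply: lseriesP => r; rewrite [RHS]lcoefM -/(lconv _ _ _).
have [r0|r0] := ltP r 0.
  rewrite negE // (@lconv_window _ _ _ _ 0 0) ?big_ord0 // => k _.
  have [k0|k0] := ltP (k - 0) 0; first by rewrite negE ?mul0r.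
  by rewrite [X in _ * X]negE ?mulr0 //; lia.
have [n rn] : exists n : nat, r = n%:Z by exists (absz r); lia.
rewrite (posE _ _ n) // coefM (@lconv_window _ _ _ _ 0 n.+1).
  by apply: eq_bigr => k _; have kn := ltn_ord k; congr (_ * _); apply/esym/posE; lia.
move=> k /orP[k0|Kk]; first by rewrite negE ?mul0r //; lia.
by rewrite [X in _ * X]negE ?mulr0 //; lia.
Qed.

Lemma poly_lseries_eq0 (p : {poly R}) : (poly_lseries p == 0) = (p == 0).
Proof.
apply/eqP/eqP => [p0|->]; last by apply: lseriesP => -[r|r] //=; rewrite coef0.
by apply/polyP => k; have := congr1 (fun f => lcoef f k%:Z) p0; rewrite /= coef0.
Qed.

Lemma laurent_expansion_uniq F s1 s2 :
  laurent_expansion F s1 -> laurent_expansion F s2 -> s1 = s2.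
Proof.
move=> [p1 [q1 [q10 F1 e1]]] [p2 [q2 [q20 F2 e2]]].
have pq : p1 * q2 = p2 * q1.
  apply/eqP; rewrite -tofrac_eq !rmorphM /=.
  rewrite -eqr_div ?tofrac_eq0 //.
  by rewrite -F1 -F2.
have /lseries_mulf_eq0 : poly_lseries (q1 * q2) * (s1 - s2) = 0.
  rewrite mulrBr {1}[q1 * q2]mulrC !poly_lseriesM -!mulrA e1 e2 -!poly_lseriesM.
  by rewrite mulrC pq mulrC subrr.
by rewrite poly_lseries_eq0 mulf_eq0 (negPf q10) (negPf q20) subr_eq0 => /eqP.
Qed.

End Expansion.

Section Stabilization.
Variable R : comNzRingType.

Definition stabilizes_positively (p : nat -> lpoly R) : Prop :=
  forall r0 : int, exists t0 : nat, forall t, (t0 <= t)%N ->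
    forall r, r <= r0 -> lcoef (p t) r = lcoef (p t0) r.

(* Coefficientwise limit; a sequence that stabilizes positively has exactly one,
   by [stabilizes_positively_limit] and [positive_limit_uniq]. *)
Definition positive_limit (p : nat -> lpoly R) (s : lseries R) : Prop :=
  forall r : int, exists t0 : nat, forall t, (t0 <= t)%N ->
    lcoef (p t) r = lcoef s r.

Lemma positive_limit_uniq p s1 s2 :
  positive_limit p s1 -> positive_limit p s2 -> s1 = s2.
Proof.
move=> h1 h2; apply: lseriesP => r; have [t1 e1] := h1 r; have [t2 e2] := h2 r.
by rewrite -(e1 (maxn t1 t2)) ?leq_maxl // (e2 (maxn t1 t2)) ?leq_maxr.
Qed.

Lemma stabilizes_positively_limit p :
  stabilizes_positively p -> exists s, positive_limit p s.
Proof.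
move=> /choice[t0 h].
have bnd : exists a : int, forall r, r < a -> lcoef (p (t0 r)) r = 0.
  have [a ha] := lcoef_bounded (p (t0 0)).
  exists (Order.min a 0) => r; rewrite lt_min => /andP[ra r0].
  rewrite -(h r (maxn (t0 0) (t0 r))) ?leq_maxr //.
  by rewrite (h 0) ?leq_maxl ?ha // ltW.
by exists (LSeries bnd) => r; exists (t0 r) => t tr /=; apply: h.
Qed.

Definition stabilizes_positively_mx m n (A : nat -> 'M[lpoly R]_(m, n)) : Prop :=
  forall i j, stabilizes_positively (fun t => A t i j).

Definition positive_limit_mx m n (A : nat -> 'M[lpoly R]_(m, n))
    (S : 'M[lseries R]_(m, n)) : Prop :=
  forall i j, positive_limit (fun t => A t i j) (S i j).

End Stabilization.

Definition laurent_expansion_mx (R : idomainType) m n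
    (F : 'M[{fraction {poly R}}]_(m, n)) (S : 'M[lseries R]_(m, n)) : Prop :=
  forall i j, laurent_expansion (F i j) (S i j).

Section Presentation.
Variable X : choiceType.

(* The letter (x, true) stands for x, the letter (x, false) for x^-1. *)
Definition word := seq (X * bool).

Definition generator_word (s : seq X) : word := [seq (x, true) | x <- s].

Variable rel : word -> word -> Prop.

Inductive word_eq : word -> word -> Prop :=
| WordRel u v of rel u v : word_eq u v
| WordCancel x b : word_eq [:: (x, b); (x, ~~ b)] [::]
| WordCat u u' v v' of word_eq u u' & word_eq v v' : word_eq (u ++ v) (u' ++ v')
| WordRefl u : word_eq u u
| WordSym u v of word_eq u v : word_eq v u
| WordTrans u v w of word_eq u v & word_eq v w : word_eq u w.

Definition word_eqb (u v : word) : bool := `[< word_eq u v >].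

Fact word_eqb_refl : reflexive word_eqb.
Proof. by move=> u; apply/asboolP; exact: WordRefl. Qed.
Fact word_eqb_sym : symmetric word_eqb.
Proof. by move=> u v; apply/asboolP/asboolP; exact: WordSym. Qed.
Fact word_eqb_trans : transitive word_eqb.
Proof.
by move=> v u w /asboolP uv /asboolP vw; apply/asboolP; exact: WordTrans uv vw.
Qed.

Canonical word_equiv := EquivRel word_eqb word_eqb_refl word_eqb_sym word_eqb_trans.

Definition presented_group := {eq_quot word_equiv}.
HB.instance Definition _ := Choice.on presented_group.

Definition word_class (u : word) : presented_group := \pi_({eq_quot word_equiv}) u.
Definition word_repr (x : presented_group) : word :=
  repr (x : {eq_quot word_equiv}).

Lemma word_reprK : cancel word_repr word_class.
Proof. by move=> x; rewrite /word_class /word_repr reprK. Qed.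

Lemma word_classP u v : word_class u = word_class v <-> word_eq u v.
Proof.
split; last by move=> uv; apply/eqmodP/asboolP.
by move=> /eqmodP/asboolP.
Qed.

Lemma word_repr_class u : word_eq (word_repr (word_class u)) u.
Proof. by apply/word_classP; rewrite word_reprK. Qed.

Definition inv_word (u : word) : word := [seq (l.1, ~~ l.2) | l <- rev u].

Lemma inv_word_cat u v : inv_word (u ++ v) = inv_word v ++ inv_word u.
Proof. by rewrite /inv_word rev_cat map_cat. Qed.

Lemma cat_inv_word u : word_eq (u ++ inv_word u) [::].
Proof.
elim: u => [|[x b] u IH]; first exact: WordRefl.
rewrite -cat1s inv_word_cat -catA (catA u).
apply: WordTrans (WordCancel x b).
apply: (WordCat (v' := [:: (x, ~~ b)])) (WordRefl _) _.
exact: (WordCat (u' := [::])) IH (WordRefl _).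
Qed.

Lemma inv_cat_word u : word_eq (inv_word u ++ u) [::].
Proof.
elim: u => [|[x b] u IH]; first exact: WordRefl.
rewrite -cat1s inv_word_cat -catA (catA (inv_word [:: _])).
apply: WordTrans IH; apply: WordCat (WordRefl _) _.
apply: (WordCat (u' := [::])) _ (WordRefl u).
by have := WordCancel x (~~ b); rewrite negbK.
Qed.

Definition pg_one : presented_group := word_class [::].
Definition pg_mul x y : presented_group := word_class (word_repr x ++ word_repr y).
Definition pg_inv x : presented_group := word_class (inv_word (word_repr x)).

Lemma pg_mulE u v : pg_mul (word_class u) (word_class v) = word_class (u ++ v).
Proof. by apply/word_classP/WordCat; apply: word_repr_class. Qed.

Fact pg_mulA : associative pg_mul.
Proof.
move=> x y z; rewrite -(word_reprK x) -(word_reprK y) -(word_reprK z).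
by rewrite !pg_mulE catA.
Qed.
Fact pg_mul1 : left_id pg_one pg_mul.
Proof. by move=> x; rewrite -(word_reprK x) pg_mulE. Qed.
Fact pg_mulr1 : right_id pg_one pg_mul.
Proof. by move=> x; rewrite -(word_reprK x) pg_mulE cats0. Qed.
Fact pg_mulV : left_inverse pg_one pg_inv pg_mul.
Proof.
move=> x; rewrite -{2}(word_reprK x) pg_mulE; apply/word_classP.
exact: inv_cat_word.
Qed.
Fact pg_mulrV : right_inverse pg_one pg_inv pg_mul.
Proof.
move=> x; rewrite -{1}(word_reprK x) pg_mulE; apply/word_classP.
exact: cat_inv_word.
Qed.

HB.instance Definition _ := isGroup.Build presented_group
  pg_mulA pg_mul1 pg_mulr1 pg_mulV pg_mulrV.

Definition pg_generator (x : X) : presented_group := word_class [:: (x, true)].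

Section Lift.
Variables (G : groupType) (f : X -> G).
Local Open Scope group_scope.

Definition word_eval (u : word) : G :=
  \prod_(l <- u) (if l.2 then f l.1 else (f l.1)^-1).

Definition respects_relations : Prop :=
  forall u v, rel u v -> word_eval u = word_eval v.

Hypothesis frel : respects_relations.

Lemma word_eval_eq u v : word_eq u v -> word_eval u = word_eval v.
Proof.
elim=> {u v} [u v /frel //|x [] | u u' v v' _ uu' _ vv'|//|//|u v w _ -> _ -> //].
- by rewrite /word_eval !big_cons big_nil /= mulg1 mulgV.
- by rewrite /word_eval !big_cons big_nil /= mulg1 mulVg.
by rewrite /word_eval !big_cat -/(word_eval u) -/(word_eval v) uu' vv'.
Qed.

Definition pg_lift (x : presented_group) : G := word_eval (word_repr x).

Lemma pg_lift_word u : pg_lift (word_class u) = word_eval u.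
Proof. by apply: word_eval_eq; apply: word_repr_class. Qed.

Lemma pg_lift_generator x : pg_lift (pg_generator x) = f x.
Proof. by rewrite pg_lift_word /word_eval big_cons big_nil mulg1. Qed.

Lemma pg_lift_morphism : monoid.monoid_morphism pg_lift.
Proof.
split; first by rewrite pg_lift_word /word_eval big_nil.
move=> x y; rewrite -(word_reprK x) -(word_reprK y).
rewrite [(_ * _)%g]pg_mulE !pg_lift_word.
by rewrite /word_eval big_cat.
Qed.

End Lift.
End Presentation.

(* The letter k : 'I_n.-1, counted from 0, is the generator sigma_(k+1). *)
Inductive braid_relation (n : nat) : word 'I_n.-1 -> word 'I_n.-1 -> Prop :=
| BraidFar (i j : 'I_n.-1) of (i.+1 < j)%N :
    braid_relation (generator_word [:: i; j]) (generator_word [:: j; i])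
| BraidAdjacent (i j : 'I_n.-1) of j = i.+1 :> nat :
    braid_relation (generator_word [:: i; j; i]) (generator_word [:: j; i; j]).

Definition braid_group (n : nat) := presented_group (@braid_relation n).
HB.instance Definition _ n := Group.on (braid_group n).

Definition sigma (n : nat) (k : 'I_n.-1) : braid_group n :=
  pg_generator (@braid_relation n) k.

Definition full_twist (n : nat) : braid_group n :=
  ((\prod_(k < n.-1) sigma k) ^+ n)%g.

Section GeneralLinear.
Variables (n : nat) (R : comUnitRingType).

Record general_linear := GeneralLinear {
  gl_mx :> 'M[R]_n;
  gl_mx_unit : gl_mx \in unitmx
}.

HB.instance Definition _ := [isSub for gl_mx].
HB.instance Definition _ := [Choice of general_linear by <:].

Fact gl_mul_unit (A B : general_linear) : gl_mx A *m gl_mx B \in unitmx.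
Proof. by rewrite unitmx_mul !gl_mx_unit. Qed.
Fact gl_inv_unit (A : general_linear) : invmx (gl_mx A) \in unitmx.
Proof. by rewrite unitmx_inv gl_mx_unit. Qed.

Definition gl_one := GeneralLinear (unitmx1 R n).
Definition gl_mul A B := GeneralLinear (gl_mul_unit A B).
Definition gl_inv A := GeneralLinear (gl_inv_unit A).

Fact gl_mulA : associative gl_mul.
Proof. by move=> A B C; apply: val_inj; rewrite /= mulmxA. Qed.
Fact gl_mul1 : left_id gl_one gl_mul.
Proof. by move=> A; apply: val_inj; rewrite /= mul1mx. Qed.
Fact gl_mulr1 : right_id gl_one gl_mul.
Proof. by move=> A; apply: val_inj; rewrite /= mulmx1. Qed.
Fact gl_mulV : left_inverse gl_one gl_inv gl_mul.
Proof. by move=> A; apply: val_inj; rewrite /= mulVmx ?gl_mx_unit. Qed.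
Fact gl_mulrV : right_inverse gl_one gl_inv gl_mul.
Proof. by move=> A; apply: val_inj; rewrite /= mulmxV ?gl_mx_unit. Qed.

HB.instance Definition _ := isGroup.Build general_linear
  gl_mulA gl_mul1 gl_mulr1 gl_mulV gl_mulrV.

End GeneralLinear.

Section BurauMatrix.
Variables (R : comUnitRingType) (t : R) (n : nat).

(* Indices are counted from 0, so the nontrivial 2 x 2 block occupies the rows
   and columns k and k.+1. *)
Definition burau_mx (k : 'I_n.-1) : 'M[R]_n :=
  \matrix_(i, j)
    if (i == k :> nat) && (j == k :> nat) then 1 - t
    else if (i == k :> nat) && (j == k.+1 :> nat) then t
    else if (i == k.+1 :> nat) && (j == k :> nat) then 1
    else if (i == k.+1 :> nat) && (j == k.+1 :> nat) then 0
    else (i == j)%:R.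

Let col_ (k : 'I_n.-1) : 'cV[R]_n :=
  \col_i ((i == k.+1 :> nat)%:R - t * (i == k :> nat)%:R).
Let row_ (k : 'I_n.-1) : 'rV[R]_n :=
  \row_j ((j == k :> nat)%:R - (j == k.+1 :> nat)%:R).

Let burau_mxE k : burau_mx k = 1%:M + col_ k *m row_ k.
Proof.
apply/matrixP => i j; rewrite !mxE big_ord1 !mxE.
rewrite -[i == j]/(i == j :> nat).
have [ik|ik] := eqVneq (i : nat) k; have [jk|jk] := eqVneq (j : nat) k;
  have [ik1|ik1] := eqVneq (i : nat) k.+1;
  have [jk1|jk1] := eqVneq (j : nat) k.+1; try (exfalso; lia) => /=.
all: try (have -> : (nat_of_ord i == nat_of_ord j) = true by lia).
all: try (have -> : (nat_of_ord i == nat_of_ord j) = false by lia).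
all: rewrite /= ?mulr1n ?mulr0n; try ring.
Qed.

Let row_col k l : row_ k *m col_ l =
  ((k == l.+1 :> nat)%:R - t * (k == l :> nat)%:R
   - ((k == l :> nat)%:R - t * (k.+1 == l :> nat)%:R))%:M.
Proof.
have kn := ltn_ord k.
have kn0 : (k < n)%N by lia.
have kn1 : (k.+1 < n)%N by lia.
apply/matrixP => i j; rewrite !ord1 !mxE mulr1n.
rewrite (bigD1 (Ordinal kn0)) // (bigD1 (Ordinal kn1)) /=; last first.
  by rewrite -val_eqE /=; lia.
rewrite big1 ?addr0 => [|m /andP[]]; last first.
  rewrite -!val_eqE /= !mxE => /negPf -> /negPf ->.
  by rewrite subrr mul0r.
rewrite !mxE /= !eqxx eqSS.
have -> : (nat_of_ord k == k.+1) = false by lia.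
have -> : (k.+1 == nat_of_ord k) = false by lia.
by rewrite /= subr0 sub0r mul1r mulN1r.
Qed.

Let u k := col_ k *m row_ k.

Let u_mul k l c : row_ k *m col_ l = c%:M -> u k *m u l = c *: (col_ k *m row_ l).
Proof.
move=> e; rewrite /u mulmxA -(mulmxA (col_ k)) e mul_mx_scalar -scalemxAl.
by [].
Qed.

Let u_sqr k : u k *m u k = - (1 + t) *: u k.
Proof.
apply: u_mul; rewrite row_col eqxx.
have -> : (nat_of_ord k == k.+1) = false by lia.
have -> : (k.+1 == nat_of_ord k) = false by lia.
by congr (_%:M); rewrite /= mulr0 mulr1; ring.
Qed.

Let u_far (k l : 'I_n.-1) : (k.+1 < l)%N -> u k *m u l = 0 /\ u l *m u k = 0.
Proof.
move=> kl; split; rewrite (u_mul (c := 0)) ?scale0r // row_col.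
  have -> : (nat_of_ord k == l.+1) = false by lia.
  have -> : (nat_of_ord k == l) = false by lia.
  have -> : (k.+1 == l) = false by lia.
  by rewrite /= mulr0 !subr0.
have -> : (nat_of_ord l == k.+1) = false by lia.
have -> : (nat_of_ord l == k) = false by lia.
have -> : (l.+1 == k) = false by lia.
by rewrite /= mulr0 !subr0.
Qed.

Let u_next (k l : 'I_n.-1) : l = k.+1 :> nat ->
  u k *m u l *m u k = t *: u k /\ u l *m u k *m u l = t *: u l.
Proof.
move=> kl.
have rkl : row_ k *m col_ l = t%:M.
  rewrite row_col; have -> : (nat_of_ord k == l.+1) = false by lia.
  have -> : (nat_of_ord k == l) = false by lia.
  have -> : (k.+1 == l) = true by lia.
  by rewrite /= mulr0 mulr1 subr0 !sub0r opprK.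
have rlk : row_ l *m col_ k = 1%:M.
  rewrite row_col; have -> : (nat_of_ord l == k.+1) = true by lia.
  have -> : (nat_of_ord l == k) = false by lia.
  have -> : (l.+1 == k) = false by lia.
  by rewrite /= mulr0 !subr0.
split.
  rewrite (u_mul rkl) -scalemxAl /u mulmxA -(mulmxA (col_ k)) rlk mulmx1.
  by [].
rewrite (u_mul rlk) scale1r /u mulmxA -(mulmxA (col_ l)) rkl mul_mx_scalar.
by rewrite -scalemxAl.
Qed.

Lemma burau_mx_unit k : t \is a GRing.unit -> burau_mx k \in unitmx.
Proof.
move=> tu; have : burau_mx k *m (1%:M + t^-1 *: u k) = 1%:M.
  rewrite burau_mxE -/(u k) mulmxDr mulmx1 -scalemxAr mulmxDl mul1mx u_sqr.
  rewrite -addrA -{1 2}[u k]scale1r -scalerDl scalerA -scalerDl.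
  have -> : 1 + t^-1 * (1 - (1 + t)) = 0.
    by rewrite opprD addNKr mulrN mulVr ?subrr.
  by rewrite scale0r addr0.
by move=> /mulmx1_unit[].
Qed.

Lemma burau_mx_far (k l : 'I_n.-1) : (k.+1 < l)%N ->
  burau_mx k *m burau_mx l = burau_mx l *m burau_mx k.
Proof.
move=> /u_far[kl lk]; rewrite !burau_mxE -/(u k) -/(u l).
rewrite !mulmxDr !mulmx1 !mulmxDl !mul1mx kl lk !addr0.
by rewrite -!addrA [u k + _]addrC.
Qed.

Lemma burau_mx_adjacent (k l : 'I_n.-1) : l = k.+1 :> nat ->
  burau_mx k *m burau_mx l *m burau_mx k = burau_mx l *m burau_mx k *m burau_mx l.
Proof.
move=> /u_next[klk lkl].
have expand (v w : 'M[R]_n) : v *m v = - (1 + t) *: v -> v *m w *m v = t *: v ->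
    (1%:M + v) *m (1%:M + w) *m (1%:M + v) = 1%:M + v + w + v *m w + w *m v.
  move=> vv vwv; rewrite !(mulmxDl, mulmxDr, mul1mx, mulmx1) vv vwv.
  move: (v *m w) (w *m v) => c d; apply/matrixP => i j; rewrite !mxE; ring.
rewrite !burau_mxE -/(u k) -/(u l) !expand ?u_sqr //.
by rewrite -!addrA; congr (_ + _); rewrite addrCA; do 2![congr (_ + _)]; rewrite addrC.
Qed.

End BurauMatrix.

Definition burau_generator (n : nat) (k : 'I_n.-1) : general_linear n (lpoly int) :=
  GeneralLinear (burau_mx_unit k (lpT_unit int)).

Lemma burau_respects (n : nat) :
  respects_relations (@braid_relation n) (@burau_generator n).
Proof.
move=> _ _ [i j ij|i j ij]; apply: val_inj;
  rewrite /word_eval /generator_word !big_cons !big_nil /= ?mulmx1.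
  exact: burau_mx_far.
by rewrite !mulmxA; exact: burau_mx_adjacent.
Qed.

Definition burau (n : nat) : braid_group n -> general_linear n (lpoly int) :=
  pg_lift (@burau_generator n).

HB.instance Definition _ n :=
  isUMagmaMorphism.Build (braid_group n) (general_linear n (lpoly int)) (@burau n)
    (pg_lift_morphism (@burau_respects n)).

Lemma burau_sigma n (k : 'I_n.-1) :
  burau (sigma k) = burau_mx (lpT int) k :> 'M_n.
Proof. by rewrite /burau pg_lift_generator //; exact: burau_respects. Qed.

(* Main.v *)
Require Import Defs.
From mathcomp Require Import all_boot all_order all_algebra.
From mathcomp Require Import zify ring.

Set Implicit Arguments.
Unset Strict Implicit.
Unset Printing Implicit Defensive.

Import Order.TTheory GRing.Theory Num.Theory.
Local Open Scope ring_scope.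

(** Write [C] for the Burau matrix of [sigma_1 ... sigma_(n-1)], [e_i] for the
    rows of the identity, [eps] for the row [(1, T, ..., T^(n-1))], and [[n]]
    for [1 + T + ... + T^(n-1)].

    Every generator fixes [eps], so [eps C = eps].  The factor of [C] with
    block in position [k, k + 1] takes [e_(k+1)] to [e_k] and fixes all [e_i]
    outside its block, so that [e_i C = e_(i-1)] for [i > 0]; together with
    [eps C = eps] this forces [e_0 C = (1 - T) eps + T^n e_(n-1)].
    Applying [C] to [e_i] [n] times therefore goes down to [e_0], jumps to the
    last row, and comes down again to [e_i]: the full twist is
    [C^n = T^n I + (1 - T) E], where every row of [E] is [eps] ([coxeter_mxX]).

    Over Laurent series put [P = E / [n]].  It is idempotent because [eps] has
    entry sum [[n]], and [1 - T^n = (1 - T) [n]] turns the formula into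
    [C^n = T^n (I - P) + P].  Hence the [k]-th power of the full twist is
    [T^(n k) (I - P) + P] ([burau_full_twistE]).  Multiplication by [T^(n k)]
    pushes a Laurent series beyond any given degree once [k] is large
    ([lcoef_monomialM_eventually0]), so the coefficients of each entry are
    eventually those of [P], whose entries are [T^j / [n]]. *)

(** * The Burau matrix of the full twist *)

Section BurauFullTwist.
Variables (R : comUnitRingType) (t : R).

(** The common left fixed vector of the Burau matrices. *)
Definition weight_row (n : nat) : 'rV[R]_n := \row_j t ^+ j.

(** The image of [sigma_1 ... sigma_(n-1)] when [t] is the variable [T]. *)
Definition coxeter_mx (n : nat) : 'M[R]_n := \prod_(k < n.-1) burau_mx t k.

Lemma delta_burau_fix n (k : 'I_n.-1) (i : 'I_n) :
  i != k :> nat -> i != k.+1 :> nat ->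
  delta_mx (0 : 'I_1) i *m burau_mx t k = delta_mx 0 i.
Proof.
move=> /negPf ik /negPf ik1; apply/rowP => j; rewrite -rowE !mxE ik ik1 /=.
by rewrite eq_sym.
Qed.

Lemma delta_burau_succ n (k : 'I_n.-1) (i j : 'I_n) :
  i = k.+1 :> nat -> j = k :> nat ->
  delta_mx (0 : 'I_1) i *m burau_mx t k = delta_mx 0 j.
Proof.
move=> ik jk; apply/rowP => l; rewrite -rowE !mxE ik.
rewrite -[l == j]/(l == j :> nat) jk eqxx /=.
have -> : (k.+1 == k) = false by lia.
have [//|lk] := eqVneq (l : nat) k; rewrite /=.
have [//|lk1] := eqVneq (l : nat) k.+1.
by rewrite -[i == l]/(i == l :> nat) ik eq_sym (negPf lk1).
Qed.

Lemma delta_burau_head n (k : 'I_n.-1) (i j : 'I_n) :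
  i = k :> nat -> j = k.+1 :> nat ->
  delta_mx (0 : 'I_1) i *m burau_mx t k =
    (1 - t) *: delta_mx 0 i + t *: delta_mx 0 j.
Proof.
move=> ik jk; apply/rowP => l; rewrite -rowE !mxE ik eqxx /=.
rewrite -[l == i]/(l == i :> nat) -[l == j]/(l == j :> nat) ik jk.
have -> : (nat_of_ord k == k.+1) = false by lia.
have [lk|lk] := eqVneq (l : nat) k.
  have -> : (nat_of_ord l == k.+1) = false by lia.
  by rewrite /= mulr1 mulr0 addr0.
have [lk1|lk1] := eqVneq (l : nat) k.+1; rewrite /= mulr0 add0r ?mulr1 // mulr0.
by rewrite -[i == l]/(i == l :> nat) ik eq_sym (negPf lk).
Qed.

Lemma weight_rowE n : weight_row n = \sum_(j < n) t ^+ j *: delta_mx 0 j.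
Proof. by rewrite [LHS]row_sum_delta; apply: eq_bigr => j _; rewrite mxE. Qed.

Lemma weight_row_burau n (k : 'I_n.-1) :
  weight_row n *m burau_mx t k = weight_row n.
Proof.
have kn := ltn_ord k.
have kn0 : (k < n)%N by lia.
have kn1 : (k.+1 < n)%N by lia.
have kk1 : Ordinal kn1 != Ordinal kn0 by rewrite -val_eqE /=; lia.
(* Only the two summands in the block change, and their sum does not. *)
rewrite weight_rowE mulmx_suml (bigD1 (Ordinal kn0)) // (bigD1 (Ordinal kn1)) //=.
rewrite [RHS](bigD1 (Ordinal kn0)) // [in RHS](bigD1 (Ordinal kn1)) //=.
rewrite !addrA; congr (_ + _).
  rewrite -!scalemxAl (delta_burau_head (j := Ordinal kn1)) //.
  rewrite (delta_burau_succ (j := Ordinal kn0)) //.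
  by apply/rowP => j; rewrite !mxE exprS; ring.
apply: eq_bigr => i /andP[]; rewrite -!val_eqE /= => ik ik1.
by rewrite -scalemxAl delta_burau_fix.
Qed.

Lemma mulmx_prod_fix n (I : eqType) (v : 'rV[R]_n) (s : seq I) (A : I -> 'M[R]_n) :
  {in s, forall k, v *m A k = v} -> v *m (\prod_(k <- s) A k) = v.
Proof.
elim: s => [|k s IH] vA; first by rewrite big_nil mulmx1.
rewrite big_cons -[_ * _]/(_ *m _) mulmxA vA ?mem_head // IH // => l ls.
by rewrite vA // inE ls orbT.
Qed.

Lemma weight_row_coxeter n : weight_row n *m coxeter_mx n = weight_row n.
Proof. by apply: mulmx_prod_fix => k _; exact: weight_row_burau. Qed.

(** Among the factors of the product, taken in increasing order, those before
    [j] do not meet the index [j.+1], the factor [j] takes it to [j], and the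
    later ones do not meet [j]. *)
Lemma delta_coxeter_succ n (i j : 'I_n) : i = j.+1 :> nat ->
  delta_mx (0 : 'I_1) i *m coxeter_mx n = delta_mx 0 j.
Proof.
move=> ij; have jn : (j < n.-1)%N by have := ltn_ord i; lia.
rewrite /coxeter_mx; pose k0 := Ordinal jn.
have : pairwise (fun k l : 'I_n.-1 => k < l)%N (index_enum 'I_n.-1).
  have -> : index_enum 'I_n.-1 = enum 'I_n.-1 by rewrite -[index_enum _]enumT.
  rewrite -(pairwise_map val ltn) val_enum_ord.
  by rewrite -(sorted_pairwise ltn_trans); exact: iota_ltn_sorted.
have : k0 \in index_enum 'I_n.-1 by exact: mem_index_enum.
elim: (index_enum _) => [//|k s IH]; rewrite inE pairwise_cons.
rewrite big_cons -[_ * _]/(_ *m _) mulmxA.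
have [<- _ /andP[/allP kl _]|kk0 /= ks /andP[/allP kl sl]] := eqVneq k0 k.
  rewrite (delta_burau_succ (j := j)) //; apply: mulmx_prod_fix => l /kl /= jl.
  by apply: delta_burau_fix; lia.
have /= kj := kl _ ks.
by rewrite delta_burau_fix ?IH //; lia.
Qed.

(** The image of the first row is found without multiplying the factors out:
    it is the only unknown left in the equation saying that [weight_row] is
    fixed. *)
Lemma delta_coxeter0 m :
  delta_mx (0 : 'I_1) (ord0 : 'I_m.+1) *m coxeter_mx m.+1 =
    (1 - t) *: weight_row m.+1 + t ^+ m.+1 *: delta_mx 0 ord_max.
Proof.
have wC := weight_row_coxeter m.+1.
rewrite {1}weight_rowE big_ord_recl expr0 scale1r mulmxDl mulmx_suml in wC.
have {}wC := canRL (addrK _) wC; rewrite wC.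
rewrite (eq_bigr (fun i : 'I_m =>
    t *: (t ^+ i *: delta_mx 0 (widen_ord (leqnSn m) i)))).
  rewrite -scaler_sumr scalerBl scale1r -addrA; congr (_ + _).
  by rewrite weight_rowE big_ord_recr /= scalerDr scalerA -exprS opprD addrNK.
move=> i _; rewrite -scalemxAl (delta_coxeter_succ (j := widen_ord (leqnSn m) i)) //.
by rewrite scalerA -exprS.
Qed.

Lemma delta_coxeter_iter n d (i j : 'I_n) : i = (j + d)%N :> nat ->
  delta_mx (0 : 'I_1) i *m coxeter_mx n ^+ d = delta_mx 0 j.
Proof.
elim: d i => [|d IH] i ij.
  by rewrite expr0 mulmx1; congr delta_mx; apply: val_inj; rewrite /= ij addn0.
have jn : (j + d < n)%N by have := ltn_ord i; lia.
rewrite exprS -[_ * _]/(_ *m _) mulmxA (delta_coxeter_succ (j := Ordinal jn)) /=.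
  exact: IH.
by rewrite ij addnS.
Qed.

Lemma weight_row_coxeterX n d : weight_row n *m coxeter_mx n ^+ d = weight_row n.
Proof.
elim: d => [|d IH]; first by rewrite expr0 mulmx1.
by rewrite exprS -[_ * _]/(_ *m _) mulmxA weight_row_coxeter.
Qed.

(** The powers of the matrix run each row [i] once around the cycle
    [i, i - 1, ..., 0, n - 1, ..., i]; the step from [0] to [n - 1] contributes
    the factor [t ^+ n] and the fixed summand [(1 - t) *: weight_row]. *)
Lemma coxeter_mxX n i j : (coxeter_mx n ^+ n) i j =
  t ^+ n * (i == j)%:R + (1 - t) * t ^+ j.
Proof.
case: n i j => [[]//|m] i j.
suff : delta_mx (0 : 'I_1) i *m coxeter_mx m.+1 ^+ m.+1 =
    (1 - t) *: weight_row m.+1 + t ^+ m.+1 *: delta_mx 0 i.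
  by move/rowP/(_ j); rewrite -rowE !mxE addrC [j == i]eq_sym.
have im : (i <= m)%N by rewrite -ltnS.
have -> : coxeter_mx m.+1 ^+ m.+1 = coxeter_mx m.+1 ^+ i *m
    (coxeter_mx m.+1 *m coxeter_mx m.+1 ^+ (m - i)).
  rewrite -[_ *m _ ^+ _]exprS -[_ *m _]exprD; congr (_ ^+ _); lia.
rewrite !mulmxA (delta_coxeter_iter (j := ord0)) // delta_coxeter0.
rewrite mulmxDl -!scalemxAl weight_row_coxeterX.
by rewrite (delta_coxeter_iter (j := i)) //=; lia.
Qed.

End BurauFullTwist.

(** * From the braid group to matrices *)

Lemma gl_mxX n (R : comUnitRingType) (x : general_linear n R) k :
  gl_mx (x ^+ k)%g = gl_mx x ^+ k.
Proof.
elim: k => [|k IH]; first by rewrite expg0.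
by rewrite expgS exprS -IH.
Qed.

Lemma burauX n (x : braid_group n) k : burau (x ^+ k)%g = (burau x ^+ k)%g.
Proof. exact: gmulfXn. Qed.

Lemma burauM n (x y : braid_group n) : burau (x * y)%g = (burau x * burau y)%g.
Proof. exact: gmulfM. Qed.

Lemma burau1 n : burau (1%g : braid_group n) = 1%g.
Proof. exact: gmulf1. Qed.

Lemma burau_coxeter n :
  gl_mx (burau (\prod_(k < n.-1) sigma k)%g) = coxeter_mx (lpT int) n.
Proof.
rewrite /coxeter_mx; elim/big_rec2: _ => [|l A x _ <-]; first by rewrite burau1.
by rewrite burauM /= burau_sigma.
Qed.

Lemma burau_full_twistX n k : gl_mx (burau (full_twist n ^+ k)%g) =
  (coxeter_mx (lpT int) n ^+ n) ^+ k.
Proof. by rewrite burauX gl_mxX /full_twist burauX gl_mxX burau_coxeter. Qed.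

(** * Geometric series *)

Section GeometricSeries.
Variable R : comNzRingType.
Implicit Types f g : lseries R.

Let T : lseries R := lmonomial R 1.

Lemma lcoefD f g r : lcoef (f + g) r = lcoef f r + lcoef g r.
Proof. by []. Qed.

Lemma lcoefB f g r : lcoef (f - g) r = lcoef f r - lcoef g r.
Proof. by []. Qed.

Lemma lcoef_monomialM (m : int) f r :
  lcoef (lmonomial R m * f) r = lcoef f (r - m).
Proof.
rewrite /= (@lconv_window _ _ _ _ (- m) 1) => [|k hk].
  by rewrite big_ord_recl big_ord0 addr0 sub0r opprK eqxx mul1r.
by rewrite (_ : _ == m = false) ?mul0r //; lia.
Qed.

Lemma lmonomialX k : T ^+ k = lmonomial R k%:Z.
Proof.
elim: k => [|k IH]; first by apply: lseriesP.
apply: lseriesP => r; rewrite exprS IH lcoef_monomialM /=.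
by congr (_%:R); lia.
Qed.

(** A Laurent series has a finite order, which the shift by [n * k] eventually
    raises above any bound. *)
Lemma lcoef_monomialM_eventually0 n f (r0 : int) :
  (0 < n)%N -> exists k0 : nat, forall k, (k0 <= k)%N ->
    forall r, r <= r0 -> lcoef (lmonomial R (n * k)%:Z * f) r = 0.
Proof.
move=> n0; have [N fN] := lcoef_nat_bound f.
exists (`|r0| + N).+1 => k kN r r_le; rewrite lcoef_monomialM fN //.
have : (k <= n * k)%N by rewrite leq_pmull.
lia.
Qed.

Lemma geometric_bounded (n : nat) : exists a : int, forall r : int,
  r < a -> ((0 <= r) && (n %| `|r|)%N)%:R = 0 :> R.
Proof. by exists 0 => r r0; rewrite leNgt r0. Qed.

(** The expansion [1 + T^n + T^(2n) + ...] of [1 / (1 - T^n)]. *)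
Definition geometric_lseries n := LSeries (geometric_bounded n).

Lemma geometric_lseriesP n : (0 < n)%N -> (1 - T ^+ n) * geometric_lseries n = 1.
Proof.
move=> n0; rewrite lmonomialX mulrBl mul1r; apply: lseriesP => r.
rewrite lcoefB lcoef_monomialM /=.
have [r0|r0] := ltP r 0.
  have -> : (0 <= r - n%:Z) = false by lia.
  by rewrite subrr lt_eqF.
have [rn|rn] := ltP r n%:Z.
  have -> : (0 <= r - n%:Z) = false by lia.
  rewrite subr0; congr (_%:R).
  have [->|rn0] := eqVneq r 0; first by rewrite dvdn0.
  by rewrite gtnNdvd //; lia.
have -> : (0 <= r - n%:Z) by lia.
have -> : `|r|%N = (`|r - n%:Z| + n)%N by lia.
rewrite dvdn_addl // subrr gt_eqF //; lia.
Qed.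

(** The expansion of [1 / (1 + T + ... + T^(n-1))], obtained as
    [(1 - T) / (1 - T^n)]. *)
Definition inv_geometric_sum n : lseries R := (1 - T) * geometric_lseries n.

Lemma inv_geometric_sumP n : (0 < n)%N ->
  (\sum_(l < n) T ^+ l) * inv_geometric_sum n = 1.
Proof.
move=> n0; rewrite mulrA -[RHS](geometric_lseriesP n0); congr (_ * _).
by rewrite -[RHS]opprB subrX1 -mulNr opprB mulrC.
Qed.

Lemma poly_lseriesD (p q : {poly R}) :
  poly_lseries (p + q) = poly_lseries p + poly_lseries q.
Proof. by apply: lseriesP => -[k|k] /=; rewrite ?coefD ?addr0. Qed.

Lemma poly_lseries0 : poly_lseries (0 : {poly R}) = 0.
Proof. by apply: lseriesP => -[k|k] /=; rewrite ?coef0. Qed.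

Lemma poly_lseriesXn k : poly_lseries ('X^k : {poly R}) = T ^+ k.
Proof. by rewrite lmonomialX; apply: lseriesP => -[l|l] //=; rewrite coefXn. Qed.

Lemma poly_lseries_geometric_sum n :
  poly_lseries (\sum_(l < n) 'X^l : {poly R}) = \sum_(l < n) T ^+ l.
Proof.
rewrite (big_morph _ poly_lseriesD poly_lseries0).
by apply: eq_bigr => l _; exact: poly_lseriesXn.
Qed.

Lemma geometric_sum_polyX_neq0 n : (0 < n)%N ->
  \sum_(l < n) 'X^l != 0 :> {poly R}.
Proof.
move=> n0; apply/eqP => /polyP/(_ 0%N)/eqP.
case: n n0 => // n _; rewrite big_ord_recl coefD coef_sum big1 => [|l _].
  by rewrite coefXn coef0 addr0 oner_eq0.
by rewrite coefXn.
Qed.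

End GeometricSeries.

(** * The limit as an idempotent matrix *)

Lemma idempotent_scale_exp (R : comNzRingType) n (c : R) (P : 'M[R]_n) k :
  P *m P = P -> (c *: (1 - P) + P) ^+ k = c ^+ k *: (1 - P) + P.
Proof.
move=> PP; elim: k => [|k IH]; first by rewrite !expr0 scale1r subrK.
have PQ : P *m (1 - P) = 0 by rewrite mulmxBr mulmx1 PP subrr.
have QP : (1 - P) *m P = 0 by rewrite mulmxBl mul1mx PP subrr.
have QQ : (1 - P) *m (1 - P) = 1 - P by rewrite mulmxBl mul1mx PQ subr0.
rewrite exprS IH -[_ * _]/(_ *m _) mulmxDl !mulmxDr -!scalemxAl -!scalemxAr.
by rewrite PQ QP QQ PP !scaler0 addr0 add0r scalerA -exprS.
Qed.

Lemma map_mxX (R S : pzRingType) (f : {rmorphism R -> S}) n (A : 'M[R]_n) k :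
  map_mx f (A ^+ k) = map_mx f A ^+ k.
Proof.
by elim: k => [|k IH]; rewrite ?expr0 ?map_mx1 // !exprS map_mxM IH.
Qed.

Definition burau_limit n : 'M[lseries int]_n :=
  \matrix_(i, j) (lmonomial int 1 ^+ j * inv_geometric_sum int n).

(** Each row is the same multiple of [(1, T, ..., T^(n-1))], scaled so that
    its entries add up to [1]. *)
Lemma burau_limit_idem n : (0 < n)%N ->
  burau_limit n *m burau_limit n = burau_limit n.
Proof.
move=> n0; apply/matrixP => i j; rewrite !mxE.
under eq_bigr do rewrite !mxE.
by rewrite -!mulr_suml inv_geometric_sumP // mul1r.
Qed.

(** This is [coxeter_mxX] with [1 - T] rewritten as
    [(1 - T^n) / (1 + T + ... + T^(n-1))]. *)
Lemma coxeter_mxX_limit n : (0 < n)%N ->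
  map_mx val (coxeter_mx (lpT int) n ^+ n) =
    lmonomial int 1 ^+ n *: (1 - burau_limit n) + burau_limit n.
Proof.
move=> n0; apply/matrixP => i j; rewrite !mxE coxeter_mxX.
rewrite rmorphD !rmorphM rmorphB rmorph_nat !rmorphXn rmorph1 /=.
have := geometric_lseriesP int n0; rewrite /inv_geometric_sum.
set x := lmonomial _ _; set g := geometric_lseries _ _ => xg.
transitivity (x ^+ n * (i == j)%:R + (1 - x) * x ^+ j * ((1 - x ^+ n) * g)).
  by rewrite xg mulr1.
by ring.
Qed.

Lemma burau_full_twist_mx n k : (0 < n)%N ->
  map_mx val (gl_mx (burau (full_twist n ^+ k)%g)) =
    lmonomial int (n * k)%:Z *: (1 - burau_limit n) + burau_limit n.
Proof.
move=> n0; rewrite burau_full_twistX map_mxX coxeter_mxX_limit //.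
by rewrite idempotent_scale_exp ?burau_limit_idem // -exprM lmonomialX.
Qed.

Lemma burau_full_twistE n k i j : (0 < n)%N ->
  gl_mx (burau (full_twist n ^+ k)%g) i j =
    lmonomial int (n * k)%:Z * (1 - burau_limit n) i j + burau_limit n i j
    :> lseries int.
Proof.
move=> /(burau_full_twist_mx k)/matrixP/(_ i j); rewrite mxE /= => ->.
by rewrite mxE; congr (_ + _); rewrite mxE.
Qed.

Theorem proposition4p8 (n : nat) (hn : (2 <= n)%N) :
  stabilizes_positively_mx
    (fun k : nat => gl_mx (burau (full_twist n ^+ k)%g)) /\
  exists2 Psi : 'M[lseries int]_n,
    positive_limit_mx
      (fun k : nat => gl_mx (burau (full_twist n ^+ k)%g)) Psi &
    laurent_expansion_mx
      (\matrix_(i < n, j < n) (tofrac 'X^j / tofrac (\sum_(l < n) 'X^l)))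
      Psi.
Proof.
have n0 : (0 < n)%N by exact: leq_trans hn.
have limit i j r0 : exists t0 : nat, forall t, (t0 <= t)%N -> forall r, r <= r0 ->
    lcoef (gl_mx (burau (full_twist n ^+ t)%g) i j) r = lcoef (burau_limit n i j) r.
  have [t0 h] := lcoef_monomialM_eventually0 ((1 - burau_limit n) i j) r0 n0.
  exists t0 => t /h {}h r /h coef0.
  by rewrite burau_full_twistE // lcoefD coef0 add0r.
split=> [i j r0|].
  have [t0 h] := limit i j r0; exists t0 => t tt0 r rr0.
  by rewrite !h.
exists (burau_limit n) => i j.
  by move=> r; have [t0 h] := limit i j r; exists t0 => t /h; exact.
exists 'X^j, (\sum_(l < n) 'X^l); rewrite !mxE; split=> //.
  exact: geometric_sum_polyX_neq0.
by rewrite poly_lseries_geometric_sum poly_lseriesXn mulrCA inv_geometric_sumP ?mulr1.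
Qed.
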